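(* For every index set $I$ (in an ordered field $\mathbb{F}$) there is a Vatican square $L$ on $I$, with some symbol set $X$, that is not based on a group; that is, there is no group $G$, bijection $\mathbf a:I\to G$ and bijection $\sigma:G\to X$ with $L(i,j)=\sigma(\mathbf a(i)^{-1}\mathbf a(j))$ for all $i,j\in I$.
   Context: Let $\mathbb{F}$ be an ordered field and $I\subseteq\mathbb{F}$; for $d\in\mathbb{F}^+$ put $I_{(d)}=\{i\in I:i+d\in I\}$. $I$ is an index set if $|I|=|\mathbb{F}|$ and for every $d\in\mathbb{F}^+$ either $|I_{(d)}|=|\mathbb{F}|$ or $I_{(d)}=\emptyset$. A Latin square on $I$ with symbol set $X$ is a function $L:I\times I\to X$ such that for each $i\in I$ both $j\mapsto L(i,j)$ and $j\mapsto L(j,i)$ are bijections $I\to X$. $L$ is Vatican if for every $d\in\mathbb{F}^+$ with $I_{(d)}\ne\emptyset$ and every ordered pair $(x,y)$ of distinct symbols there is exactly one $(i,j)$ with $j\in I_{(d)}$, $L(i,j)=x$, $L(i,j+d)=y$, and exactly one $(i,j)$ with $i\in I_{(d)}$, $L(i,j)=x$, $L(i+d,j)=y$. A square of the form $(i,j)\mapsto \mathbf a(i)^{-1}\mathbf a(j)$ for a group $G$ and bijection $\mathbf a:I\to G$ is said to be based on $G$ (here allowing a relabelling of symbols). *)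

(* Defs.v *)
From mathcomp Require Import all_boot all_order all_algebra.
From mathcomp Require Import all_classical.

Set Implicit Arguments.
Unset Strict Implicit.
Unset Printing Implicit Defensive.

Import Order.TTheory GRing.Theory Num.Theory.
Local Open Scope classical_set_scope.
Local Open Scope ring_scope.
Local Open Scope card_scope.

Definition shift_dom (F : realFieldType) (I : set F) (d : F) : set F :=
  [set i | I i /\ I (i + d)].

Definition index_set (F : realFieldType) (I : set F) : Prop :=
  I #= [set: F] /\
  forall d : F, 0 < d ->
    shift_dom I d #= [set: F] \/ shift_dom I d = set0.

(* A square on [I] is represented by a total function [L : F -> F -> X]; only
   the values [L i j] with [i] and [j] in [I] matter. *)
Definition latin_square (F : realFieldType) (I : set F) (X : Type)
    (L : F -> F -> X) : Prop :=
  forall i, I i ->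
    set_bij I [set: X] (fun j => L i j) /\ set_bij I [set: X] (fun j => L j i).

Definition vatican_square (F : realFieldType) (I : set F) (X : Type)
    (L : F -> F -> X) : Prop :=
  latin_square I L /\
  forall d : F, 0 < d -> shift_dom I d !=set0 ->
  forall x y : X, x <> y ->
    (exists! p : F * F,
       [/\ I p.1, shift_dom I d p.2, L p.1 p.2 = x & L p.1 (p.2 + d) = y]) /\
    (exists! p : F * F,
       [/\ shift_dom I d p.1, I p.2, L p.1 p.2 = x & L (p.1 + d) p.2 = y]).

(* [groupType] is not restricted to finite groups. *)
Definition based_on (F : realFieldType) (I : set F) (X : Type)
    (L : F -> F -> X) (G : groupType) : Prop :=
  exists (a : F -> G) (sigma : G -> X),
    [/\ set_bij I [set: G] a, bijective sigma &
      forall i j, I i -> I j -> L i j = sigma ((a i)^-1 * a j)%g].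

(* Main.v *)
(* Transfinite greedy construction with the symbol set F.  Well-order F so that
   every proper initial segment has fewer than |F| elements, and enumerate along
   it the |F| requirements "cell (i, j) is filled", "symbol x occurs in row
   (column) i", "the ordered pair (x, y) occurs at distance d in some row
   (column)".  Before each stage fewer than |F| cells are filled, so fewer than
   |F| scalars have the form a + b - c with a, b, c rows, columns or symbols in
   use; as I and each nonempty I_(d) have |F| elements, at most two new cells
   placed in rows, columns or with symbols avoiding these scalars meet the
   current requirement without repeating a pair at any distance.
   A square a(i)^-1 a(j) based on a group is constant on its diagonal, so it
   suffices to start from two different symbols on the diagonal. *)
Require Import Defs.
From Stdlib Require Import Wellfounded.
From mathcomp Require Import all_boot all_order all_algebra.
From mathcomp Require Import all_classical wochoice lra.

Set Implicit Arguments.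
Unset Strict Implicit.
Unset Printing Implicit Defensive.

Import Order.TTheory GRing.Theory Num.Theory.
Local Open Scope classical_set_scope.
Local Open Scope card_scope.

(** * Cardinal arithmetic *)

Lemma card_le_fun T U (A : set T) (B : set U) (f : T -> U) :
  set_fun A B f -> set_inj A f -> A #<= B.
Proof.
move=> fAB fI; have [g] : $|{injfun A >-> B}| by apply/injfunPex; exists f.
exact: inj_card_le g.
Qed.

Lemma card_le_ex T U (u0 : U) (A : set T) (B : set U) :
  A #<= B -> exists2 f : T -> U, set_fun A B f & set_inj A f.
Proof.
by elim/Ppointed: U => U in u0 B *; [case: (no u0) | move=> /pcard_leP/injfunPex].
Qed.

Lemma card_le_rel T U (A : set T) (B : set U) (G : T -> U -> Prop) :
  (forall a, A a -> exists2 b, B b & G a b) ->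
  (forall a a' b, G a b -> G a' b -> a = a') -> A #<= B.
Proof.
move=> Gtot Ginj; have [->|/set0P[a0 Aa0]] := eqVneq A set0; first by [].
have [b0 Bb0 _] := Gtot _ Aa0.
have /choice[f fP] : forall a, exists b, A a -> B b /\ G a b.
  move=> a; have [Aa|NA] := pselect (A a); last by exists b0.
  by have [b Bb Gab] := Gtot a Aa; exists b.
apply: (card_le_fun (f := f)) => [a /fP[]//|a a' /set_mem/fP[_ G1] /set_mem/fP[_ G2] e].
by apply: Ginj G1 _; rewrite e.
Qed.

(** By Zorn there is a maximal graph [G] of a partial injection from [A] to [B]. It exhausts [A] or
    [B]: an [a] and a [b] both left unmatched could be added to [G] as a pair. *)
Lemma card_le_total T U (A : set T) (B : set U) : A #<= B \/ B #<= A.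
Proof.
pose P (G : set (T * U)) := [/\ G `<=` A `*` B,
  forall a a' b, G (a, b) -> G (a', b) -> a = a' &
  forall a b b', G (a, b) -> G (a, b') -> b = b'].
have [] := @Zorn_bigcup _ P.
  move=> Fam FamP tot; split.
  - by move=> p [G /FamP[GAB _ _]] /GAB.
  - move=> a a' b [G FG Gab] [G' FG' Gab'].
    have [/(_ _ Gab) G'ab|/(_ _ Gab') Gab2] := tot _ _ FG FG'.
      by case: (FamP _ FG') => _ /(_ a a' b) + _; apply.
    by case: (FamP _ FG) => _ /(_ a a' b) + _; apply.
  - move=> a b b' [G FG Gab] [G' FG' Gab'].
    have [/(_ _ Gab) G'ab|/(_ _ Gab') Gab2] := tot _ _ FG FG'.
      by case: (FamP _ FG') => _ _ /(_ a b b'); apply.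
    by case: (FamP _ FG) => _ _ /(_ a b b'); apply.
move=> G [[GAB GI GF] Gmax].
have [Gtot|/existsNP[a /not_implyP[Aa Na]]] :=
    pselect (forall a, A a -> exists2 b, B b & G (a, b)).
  by left; apply: (card_le_rel (G := fun a b => G (a, b))).
right; apply: (card_le_rel (G := fun b a => G (a, b))) => [b Bb|b b' c]; last exact: GF.
apply: contrapT => Nb; apply: (Gmax (G `|` [set (a, b)])).
  split; first by move=> p; left.
  by move=> /(_ (a, b) (or_intror erefl)) Gab; apply: Na; exists b.
have na b' : ~ G (a, b') by move=> Gab; apply: Na; exists b' => //; case: (GAB _ Gab).
have nb a' : ~ G (a', b) by move=> Gab; apply: Nb; exists a' => //; case: (GAB _ Gab).
split.
- by move=> p [/GAB//|->].
- move=> x x' y [Gxy|[ex ey]] [Gxy'|[ex' ey']].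
  + exact: GI Gxy Gxy'.
  + by case: (nb x); rewrite -ey'.
  + by case: (nb x'); rewrite -ey.
  + by rewrite ex ex'.
- move=> x y y' [Gxy|[ex ey]] [Gxy'|[ex' ey']].
  + exact: GF Gxy Gxy'.
  + by case: (na y); rewrite -ex'.
  + by case: (na y'); rewrite -ex.
  + by rewrite ey ey'.
Qed.

Lemma Zorn_above T (P : set (set T)) (A0 : set T) : P A0 ->
  (forall F : set (set T), F `<=` P -> total_on F subset ->
    P (\bigcup_(X in F) X)) ->
  exists M, [/\ A0 `<=` M, P M & forall B, M `<` B -> ~ P B].
Proof.
move=> PA0 PU; pose Q A := P (A0 `|` A).
have [] := @Zorn_bigcup _ Q.
  move=> F FQ totF; rewrite /Q.
  (* Adjoining [A0] to the family as a member of its own keeps it a chain and makes the equality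
     hold for the empty chain too. *)
  have -> : A0 `|` \bigcup_(X in F) X =
      \bigcup_(X in [set A0] `|` [set A0 `|` X | X in F]) X.
    apply/seteqP; split=> [x [A0x|[X FX Xx]]|x [X [->|[Y FY <-]] Xx]].
    - by exists A0 => //; left.
    - by exists (A0 `|` X); [right; exists X|right].
    - by left.
    - by case: Xx => [?|Yx]; [left|right; exists Y].
  apply: PU => [X [->//|[Y FY <-]]|X Y [->|[X' FX <-]] [->|[Y' FY <-]]].
  - exact: FQ.
  - by left.
  - by left; apply: subsetUl.
  - by right; apply: subsetUl.
  - by have [H|H] := totF _ _ FX FY; [left|right]; apply: setUS.
move=> M [QM Mmax]; exists (A0 `|` M); split=> // B [MB NB] PB.
have A0B : A0 `<=` B by apply: subset_trans MB; apply: subsetUl.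
apply: (Mmax B); last by rewrite /Q ((setUidPr _ _).2 A0B).
split; first by apply: subset_trans MB; apply: subsetUr.
by move=> BM; apply: NB => x /BM; right.
Qed.

(** * Hessenberg's theorem: an infinite set is as large as its square *)

Section Hessenberg.
Variables (T : Type) (D : set T).

Let fld (R : set (T * T * T)) : set T := [set a | exists c, R (a, a, c)].

(* [R] is the graph of a (possibly multivalued) injection of
   [fld R `*` fld R] into [fld R]. *)
Let pairing (R : set (T * T * T)) := [/\
  forall a b c, R (a, b, c) -> [/\ D a, fld R a, fld R b & fld R c],
  forall a b, fld R a -> fld R b -> exists c, R (a, b, c) &
  forall a b a' b' c, R (a, b, c) -> R (a', b', c) -> a = a' /\ b = b'].

Let pairing_bigcup (F : set (set (T * T * T))) :
  F `<=` pairing -> total_on F subset -> pairing (\bigcup_(X in F) X).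
Proof.
move=> Fp tot.
have fldU X : F X -> fld X `<=` fld (\bigcup_(X in F) X).
  by move=> FX a [c Xc]; exists c, X.
have two p q : (\bigcup_(X in F) X) p -> (\bigcup_(X in F) X) q ->
    exists X, [/\ F X, X p & X q].
  move=> [X FX Xp] [Y FY Yq]; have [/(_ _ Xp) ?|/(_ _ Yq) ?] := tot _ _ FX FY.
    by exists Y.
  by exists X.
split.
- move=> a b c [X FX Xabc]; have [/(_ _ _ _ Xabc)[Da Xa Xb Xc] _ _] := Fp _ FX.
  by split=> //; apply: fldU FX _ _.
- move=> a b [c Hc] [c' Hc']; have [X [FX Xp Xq]] := two _ _ Hc Hc'.
  have [_ /(_ a b) + _] := Fp _ FX.
  by move=> []; [exists c|exists c'|move=> e Xe; exists e, X].
- move=> a b a' b' c H H'; have [X [FX Xp Xq]] := two _ _ H H'.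
  by have [_ _ ] := Fp _ FX; apply; [exact: Xp|exact: Xq].
Qed.

(** Take a maximal pairing above a countable one, with field [A]. If [A] injects into its complement
    in [D], a disjoint copy [B] of [A] extends the pairing, against maximality. Otherwise the
    complement injects into [A], so [D] injects into [A] and the pairing on [A] serves for [D]. *)
Lemma card_le_square : infinite_set D -> D `*` D #<= D.
Proof.
move=> /infiniteP Dinf.
have [d0 Dd0] : D !=set0.
  by apply: infinite_setN0; apply/infiniteP.
have [h hD hI] := card_le_ex d0 Dinf.
have /(card_le_ex 0) [phi _ phiI] : [set: nat * nat] #<= [set: nat].
  by have /card_eqPle[] := card_nat2.
have {}hI m n : h m = h n -> m = n by move=> ?; apply: hI; rewrite ?inE.
have {}phiI p q : phi p = phi q -> p = q by move=> ?; apply: phiI; rewrite ?inE.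
(* The pairing of [nat] carried along [h]. Starting from it keeps every [h m] in the field of [R],
   where these elements serve as tags. *)
pose R0 : set (T * T * T) :=
  [set p | exists m n, p = (h m, h n, h (phi (m, n)))].
have fR0 m : fld R0 (h m) by exists (h (phi (m, m))), m, m.
have PR0 : pairing R0.
  split.
  - by move=> a b c [m [n [-> -> ->]]]; split=> //; exact: hD.
  - move=> a b [c [m [n [-> _ _]]]] [c' [m' [n' [-> _ _]]]].
    by exists (h (phi (m, m'))), m, m'.
  - move=> a b a' b' c [m [n [-> -> ->]]] [m' [n' [-> -> e]]].
    by have /phiI[-> ->] := hI _ _ e.
have [R [R0R [Rfld Rtot RI] Rmax]] := Zorn_above PR0 pairing_bigcup.
pose A := fld R.
have AD : A `<=` D by move=> a [c /Rfld[]].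
have fA m : A (h m) by have [c ?] := fR0 m; exists c; apply: R0R.
have /choice[f fP] : forall p, exists c, A p.1 -> A p.2 -> R (p, c).
  move=> [a b]; have [[Aa Ab]|N] := pselect (A a /\ A b).
    by have [c ?] := Rtot _ _ Aa Ab; exists c.
  by exists a => Aa Ab; case: N.
have fAA a b : A a -> A b -> A (f (a, b)).
  by move=> Aa Ab; have /= /(_ Aa Ab)/Rfld[] := fP (a, b).
have fI a b a' b' : A a -> A b -> A a' -> A b' -> f (a, b) = f (a', b') ->
    a = a' /\ b = b'.
  move=> Aa Ab Aa' Ab' e; have /= /(_ Aa Ab) := fP (a, b).
  by rewrite e => H; apply: RI H _; have /= := fP (a', b'); apply.
have [DA|AE] := card_le_total (D `\` A) A; last first.
  have [b bE bI] := card_le_ex d0 AE; exfalso.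
  have {}bI a a' : A a -> A a' -> b a = b a' -> a = a'.
    by move=> Aa Aa'; apply: bI; rewrite inE.
  pose B := b @` A.
  have BA x : B x -> ~ A x by move=> [a /bE[_ NA] <-].
  (* [r] folds [A] and its copy [B] back onto [A]: the identity on [A], the inverse of [b] on
     [B]. *)
  have /choice[r rP] : forall x, exists a, (A x -> a = x) /\ (B x -> A a /\ x = b a).
    move=> x; have [Ax|NA] := pselect (A x); first by exists x; split=> // /BA.
    have [[a Aa <-]|NB] := pselect (B x); last by exists x.
    by exists a; split=> // Aba; case: (BA (b a)) => //; exists a.
  pose AB := A `|` B.
  have rA x : AB x -> A (r x).
    by move=> [Ax|Bx]; [rewrite (rP x).1|have [] := (rP x).2 Bx].
  (* Folding by [r] forgets on which side [x] and [y] lay. Pairs with both in [A] are already coded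
     by [R], so three tags recover the sides; the outer [b] in [g] puts new codes in [B], away from
     the old ones. *)
  pose tag x y := h (if `[< A x >] then 0 else if `[< A y >] then 1 else 2).
  pose g x y := b (f (f (r x, r y), tag x y)).
  have gB x y : AB x -> AB y -> B (g x y).
    by move=> ABx ABy; apply: imageP; apply: (fAA _ _ _ (fA _)); apply: fAA; apply: rA.
  pose R' := R `|` [set p | exists x y,
    [/\ AB x, AB y, ~ (A x /\ A y) & p = (x, y, g x y)]].
  have fldR' x : AB x <-> fld R' x.
    split=> [ABx|[c [Rc|[x' [y [ABx _ _ [-> _ _]]]]]] //]; last by left; exists c.
    have [Ax|NA] := pselect (A x).
      by have [c ?] := Ax; exists c; left.
    by exists (g x x); right; exists x, x; split=> // -[].
  apply: (Rmax R'); first split=> [p|R'R]; first by left.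
    have Bb : B (b (h 0)) by apply: imageP.
    have /fldR'[c /R'R Rc] : AB (b (h 0)) by right.
    by apply: (BA _ Bb); exists c.
  split.
  - move=> x y c [Rp|[x' [y' [ABx ABy N [-> -> ->]]]]].
      by have [Dx Ax Ay Ac] := Rfld _ _ _ Rp; split=> //; apply/fldR'; left.
    split; [| exact/fldR'| exact/fldR'|by apply/fldR'; right; apply: gB].
    by case: ABx => [/AD//|[a /bE[? _] <-]].
  - move=> x y /fldR' ABx /fldR' ABy.
    have [[Ax Ay]|N] := pselect (A x /\ A y).
      by have [c ?] := Rtot _ _ Ax Ay; exists c; left.
    by exists (g x y); right; exists x, y.
  - move=> x y x' y' c [Rp|[u [v [ABx ABy N [-> -> ->]]]]].
      move=> [|[u' [v' [ABu' ABv' N' [-> -> e]]]]]; first exact: RI Rp.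
      have [_ _ _] := Rfld _ _ _ Rp; rewrite e => Ac.
      by case: (BA _ (gB _ _ ABu' ABv')).
    move=> [Rp|[u' [v' [ABu' ABv' N' [-> -> e]]]]].
      have [_ _ _ Ac] := Rfld _ _ _ Rp.
      by case: (BA _ (gB _ _ ABx ABy)).
    have fr z w : AB z -> AB w -> A (f (r z, r w)).
      by move=> ABz ABw; apply: fAA; apply: rA.
    have {e}[ef et] := fI _ _ _ _ (fr _ _ ABx ABy) (fA _) (fr _ _ ABu' ABv') (fA _)
      (bI _ _ (fAA _ _ (fr _ _ ABx ABy) (fA _)) (fAA _ _ (fr _ _ ABu' ABv') (fA _)) e).
    have {}ef := fI _ _ _ _ (rA _ ABx) (rA _ ABy) (rA _ ABu') (rA _ ABv') ef.
    have [AA1 AA2] : (A u <-> A u') /\ (A v <-> A v').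
      by move/hI: et; do 4?case: asboolP; move=> *; (done || tauto).
    have rE z w : AB z -> AB w -> (A z <-> A w) -> r z = r w -> z = w.
      move=> ABz ABw AzAw e'; have [Az|NA] := pselect (A z).
        by rewrite -((rP z).1 Az) -((rP w).1 (AzAw.1 Az)).
      have [_ ->] : A (r z) /\ z = b (r z) by apply: (rP z).2; case: ABz.
      have [_ ->] : A (r w) /\ w = b (r w).
        by apply: (rP w).2; case: ABw => // /AzAw.
      by rewrite e'.
    by split; apply: rE => //; case: ef.
have [k kA kI] := card_le_ex d0 DA.
(* Tags [h 0] and [h 1] keep the images of [A] and of its complement apart, so [e] injects [D] into
   [A]. *)
pose e x := if `[< A x >] then f (x, h 0) else f (k x, h 1).
have eA x : D x -> A (e x).
  by rewrite /e => Dx; case: asboolP => [Ax|NA]; apply: fAA => //; apply: kA.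
have eI x y : D x -> D y -> e x = e y -> x = y.
  rewrite /e => Dx Dy; have kA' z : D z -> ~ A z -> A (k z) by move=> *; apply: kA.
  case: asboolP => [Ax|NAx]; case: asboolP => [Ay|NAy] /fI[] //; auto; try by move=> _ /hI.
  by move=> exy _; apply: kI => //; rewrite inE.
apply: (card_le_fun (f := fun p => f (e p.1, e p.2))) => [[x y] [Dx Dy]|].
  by apply: AD; apply: fAA; apply: eA.
move=> [x y] [x' y'] /set_mem[/= Dx Dy] /set_mem[/= Dx' Dy'].
by move=> /fI[]; auto => /eI-> // /eI->.
Qed.

End Hessenberg.

(** * Sets of fewer than [|K|] elements *)

Definition small (K T : Type) (A : set T) := ~ ([set: K] #<= A).

Section Small.
Variable K : Type.
Hypothesis Kinf : infinite_set [set: K].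
Local Notation small := (small K).

Lemma finite_small T (A : set T) : finite_set A -> small A.
Proof. by move=> Afin KA; apply: Kinf; apply: card_le_finite KA Afin. Qed.

Lemma small_le T U (A : set T) (B : set U) : A #<= B -> small B -> small A.
Proof. by move=> AB sB KA; apply: sB; apply: card_le_trans KA AB. Qed.

Lemma small_image T U (f : T -> U) (A : set T) : small A -> small (f @` A).
Proof. exact/small_le/card_image_le. Qed.

(** The product embeds in the square of the larger factor, which is finite or, by [card_le_square],
    no larger than that factor. *)
Lemma small_setX T U (A : set T) (B : set U) :
  small A -> small B -> small (A `*` B).
Proof.
have squares V (C : set V) : small C -> small (C `*` C).
  move=> sC; have [Cfin|Cinf] := pselect (finite_set C).
    by apply: finite_small; apply: finite_setX.
  exact: small_le (card_le_square Cinf) sC.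
have [AB|BA] := card_le_total A B => sA sB.
  apply: small_le _ (squares _ _ sB).
  (* [card_le_ex] asks for a point of the target type; without one the product is empty. *)
  have [[b0]|noU] := pselect (inhabited U); last first.
    by apply: (card_le_fun (f := fun p => (p.2, p.2))) => [[a b]|[a b]]; case: noU.
  have [f fB fI] := card_le_ex b0 AB.
  apply: (card_le_fun (f := fun p => (f p.1, p.2))) => [[a b] [/fB]//|].
  move=> [a b] [a' b'] /set_mem[/= Aa Ab] /set_mem[/= Aa' Ab'] [] e ->.
  by rewrite (fI a a') ?inE.
apply: small_le _ (squares _ _ sA).
have [[a0]|noT] := pselect (inhabited T); last first.
  by apply: (card_le_fun (f := fun p => (p.1, p.1))) => [[a b]|[a b]]; case: noT.
have [f fA fI] := card_le_ex a0 BA.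
apply: (card_le_fun (f := fun p => (p.1, f p.2))) => [[a b] [Aa /fA]//|].
move=> [a b] [a' b'] /set_mem[/= Aa Ab] /set_mem[/= Aa' Ab'] [] -> e.
by rewrite (fI b b') ?inE.
Qed.

Lemma small_setU T (A B : set T) : small A -> small B -> small (A `|` B).
Proof.
move=> sA sB.
have [->|/set0P[a0 Aa0]] := eqVneq A set0; first by rewrite set0U.
have [->|/set0P[b0 Bb0]] := eqVneq B set0; first by rewrite setU0.
have sb : small [set: bool] by apply: finite_small; exact: finite_finset.
pose f (p : (T * T) * bool) := if p.2 then p.1.1 else p.1.2.
apply: small_le _ (small_image (f := f) (small_setX (small_setX sA sB) sb)).
apply: subset_card_le => x [Ax|Bx].
  by exists ((x, b0), true).
by exists ((a0, x), false).
Qed.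

End Small.

(** * Transfinite construction *)

(** If some segment of a well-order of [K] has [|K|] elements, let [x] be the least point with such
    a segment and pull the order back along an injection [g] of [K] into it. The new segment below
    [y] injects into the old one below [g y], which is small because [g y] precedes [x]. *)
Lemma small_well_order (K : eqType) : exists lt : K -> K -> Prop,
  [/\ well_founded lt, forall x y, [\/ lt x y, x = y | lt y x],
      forall x y z, lt x y -> lt y z -> lt x z &
      forall x, small K [set y | lt y x]].
Proof.
have [R Rwo] := well_ordering_principle K.
have minP (A : set K) : A !=set0 -> exists2 z, A z & forall y, A y -> R z y.
  move=> [a Aa]; have [|z [[Az zmin] _]] := Rwo (mem A).
    by exists a; rewrite !inE.
  exists z; first by move: Az; rewrite !inE.
  by move=> y Ay; apply: zmin; rewrite !inE.
have chR : chain R predT := @wo_chainW K R predT (withinW Rwo).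
have Rtot x y : R x y || R y x by exact: chR.
have Rxx x : R x x by have := Rtot x x; rewrite orbb.
have Ranti x y : R x y -> R y x -> x = y.
  move=> Rxy Ryx; have := @wo_chain_antisymmetric K R predT (withinW Rwo).
  by move=> /(_ x y isT isT); rewrite Rxy Ryx; apply.
have Rtrans x y z : R x y -> R y z -> R x z.
  move=> Rxy Ryz; have [|w] := minP [set x; y; z]; first by exists x; left; left.
  case=> [[->|->]|->] m.
  - by apply: m; right.
  - by have -> : x = y by apply: Ranti => //; apply: m; left; left.
  - have e : y = z by apply: Ranti => //; apply: m; left; right.
    by rewrite -e.
pose lt x y := R x y /\ x <> y.
have ltwf : well_founded lt.
  move=> x; apply: contrapT => Nx.
  have [|z Nz zmin] := minP [set z | ~ Acc lt z]; first by exists x.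
  apply: Nz; constructor => y [Ryz yz]; apply: contrapT => Ny.
  by apply: yz; apply: Ranti => //; apply: zmin.
have lttot x y : [\/ lt x y, x = y | lt y x].
  have [->|/eqP xy] := eqVneq x y; first by constructor 2.
  have /orP[Rxy|Ryx] := Rtot x y; first by constructor 1.
  by constructor 3; split=> // e; apply: xy.
have lttrans x y z : lt x y -> lt y z -> lt x z.
  move=> [Rxy xy] [Ryz yz]; split; first exact: Rtrans Rxy Ryz.
  by move=> e; apply: xy; apply: Ranti => //; rewrite e.
have [smallseg|/existsNP[x0 /contrapT x0big]] :=
  pselect (forall x, small K [set y | lt y x]); first by exists lt.
have [|x Nx xmin] := minP [set x | [set: K] #<= [set y | lt y x]].
  by exists x0.
have [g gx gI] := card_le_ex x0 Nx.
have {}gI y z : g y = g z -> y = z by move=> e; apply: gI; rewrite ?inE.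
exists (fun y z => lt (g y) (g z)); split.
- exact: wf_inverse_image.
- by move=> y z; have [?|/gI|?] := lttot (g y) (g z); 
    [constructor 1|constructor 2|constructor 3].
- by move=> y z w; exact: lttrans.
- move=> y Ky; have [Rgy gyx] := gx y I.
  apply: gyx; apply: Ranti => //; apply: xmin => /=.
  apply: card_le_trans Ky _; apply: (card_le_fun (f := g)) => // z w _ _.
  exact: gI.
Qed.

(* A stage whose task is already satisfied adds [c0] again, that is, nothing. *)
Lemma transfinite_construction (K : eqType) (C : choiceType)
    (ok : C -> C -> C -> C -> Prop) (sat : K -> set C -> Prop)
    (P0 : set C) (c0 : C) :
  let good P := forall p q r s, P p -> P q -> P r -> P s -> ok p q r s in
  infinite_set [set: K] ->
  (forall k P Q, P `<=` Q -> sat k P -> sat k Q) ->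
  P0 c0 -> small K P0 -> good P0 ->
  (forall k P, P0 `<=` P -> small K P -> good P -> ~ sat k P ->
    exists c1 c2, good (P `|` [set c1; c2]) /\ sat k (P `|` [set c1; c2])) ->
  exists P, [/\ P0 `<=` P, good P & forall k, sat k P].
Proof.
move=> good Kinf satS P0c0 sP0 gP0 ext.
have [lt [ltwf lttot lttrans ltsmall]] := small_well_order K.
have good_bigcup (F : set (set C)) : total_on F subset ->
    (forall X, F X -> good X) -> good (\bigcup_(X in F) X).
  move=> tot Fg p q r s [X FX Xp] [Y FY Yq] [Z FZ Zr] [W FW Ws].
  (* The four cells tested by [ok] may come from four members of the chain; one member contains them
     all. *)
  have up A B : F A -> F B -> exists E, [/\ F E, A `<=` E & B `<=` E].
    move=> FA FB; have [AB|BA] := tot _ _ FA FB; first by exists B; split.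
    by exists A; split.
  have [E [FE XE YE]] := up _ _ FX FY; have [G [FG ZG WG]] := up _ _ FZ FW.
  have [H [FH EH GH]] := up _ _ FE FG.
  by apply: (Fg H) => //; [apply/EH/XE|apply/EH/YE|apply/GH/ZG|apply/GH/WG].
pose cells (c : C * C) : set C := [set c.1; c.2].
pose step P k : C * C := xget (c0, c0)
  [set c | good (P `|` cells c) /\ sat k (P `|` cells c)].
have stepP k P : P0 `<=` P -> small K P -> good P ->
    good (P `|` cells (step P k)) /\ sat k (P `|` cells (step P k)).
  move=> P0P sP gP.
  apply: (@xgetPex _ (c0, c0)
    [set c | good (P `|` cells c) /\ sat k (P `|` cells c)]).
  have [satk|Nsat] := pselect (sat k P); last first.
    by have [c1 [c2 H]] := ext k P P0P sP gP Nsat; exists (c1, c2).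
  exists (c0, c0) => /=.
  suff -> : P `|` cells (c0, c0) = P by [].
  by apply/setUidPl => c [->|->]; apply: P0P.
pose body k (rec : forall j, lt j k -> C * C) :=
  step (P0 `|` [set c | exists j (jk : lt j k), cells (rec j jk) c]) k.
pose rec := Fix ltwf (fun _ => (C * C)%type) body.
pose before k := P0 `|` \bigcup_(j in [set j | lt j k]) cells (rec j).
have recE k : rec k = step (before k) k.
  rewrite /rec Fix_eq => [|x f g fg]; last first.
    by congr body; apply: functional_extensionality_dep => y;
      apply: functional_extensionality_dep.
  congr step; congr (_ `|` _); apply/seteqP; split=> [c [j [jk cj]]|c [j jk cj]].
    by exists j.
  by exists j, jk.
pose upto k := before k `|` cells (rec k).
have P0b k : P0 `<=` before k by apply: subsetUl.
have beforeS j k : lt j k -> upto j `<=` before k.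
  move=> jk c [[P0c|[i ij ci]]|cj]; [by left|right; exists i|by right; exists j].
  exact: lttrans ij jk.
  by [].
have uptoS j k : lt j k -> upto j `<=` upto k.
  by move=> jk; apply: subset_trans (beforeS _ _ jk) _; apply: subsetUl.
have chain (A : set K) : total_on ([set P0] `|` [set upto j | j in A]) subset.
  have P0u j : P0 `<=` upto j by apply: subset_trans (P0b j) _; apply: subsetUl.
  move=> X Y [->|[j Aj <-]] [->|[k Ak <-]]; [by left|by left|by right|].
  have [/uptoS ?|->|/uptoS ?] := lttot j k; [by left|by left|by right].
(* Presents the cells placed so far as the union of a chain, so that [good_bigcup] applies; [P0] is
   a member in case [A] is empty. *)
have unionE (A : set K) : (forall j k, A k -> lt j k -> A j) ->
    P0 `|` \bigcup_(j in A) cells (rec j) =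
    \bigcup_(X in [set P0] `|` [set upto j | j in A]) X.
  move=> Adown; apply/seteqP; split=> [c [P0c|[j Aj cj]]|c].
  - by exists P0 => //; left.
  - by exists (upto j); [right; exists j|right].
  - move=> [X [->|[j Aj <-]]]; first by left.
    move=> [[P0c|[i ij ci]]|cj]; [by left|right; exists i|by right; exists j].
    exact: Adown ij.
    by [].
have bsmall k : small K (before k).
  apply: small_setU => //.
  pose f (p : K * bool) := if p.2 then (rec p.1).1 else (rec p.1).2.
  have sb : small K [set: bool] by apply: (finite_small Kinf); exact: finite_finset.
  apply: small_le _ (small_image (f := f) (small_setX Kinf (ltsmall k) sb)).
  apply: subset_card_le => c [j jk [->|->]]; first by exists (j, true).
  by exists (j, false).
have stage k : good (upto k) /\ sat k (upto k).
  elim/(well_founded_ind ltwf): k => k IH.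
  rewrite /upto recE; apply: stepP => //.
  rewrite /before unionE; last by move=> i j /= jk ij; exact: lttrans ij jk.
  apply: good_bigcup; first exact: chain.
  by move=> X [->//|[j jk <-]]; have [] := IH j jk.
exists (P0 `|` \bigcup_(j in [set: K]) cells (rec j)).
rewrite unionE //; split.
- by move=> c P0c; exists P0 => //; left.
- apply: good_bigcup; first exact: chain.
  by move=> X [->//|[j _ <-]]; have [] := stage j.
- move=> k; apply: (satS _ (upto k)); last by have [] := stage k.
  by move=> c ck; exists (upto k) => //; right; exists k.
Qed.

Local Open Scope ring_scope.

(** * Partial Vatican squares *)

Section PartialSquares.
Variables (F : realFieldType) (I : set F).

(* A cell [(i, j, x)] records the entry [x] in row [i] and column [j]. *)
Local Notation cell := (F * F * F)%type.

Definition transpose_cell (c : cell) : cell := (c.1.2, c.1.1, c.2).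

Definition transpose (P : set cell) : set cell := [set c | P (transpose_cell c)].

(** The uniqueness halves of the Latin and Vatican conditions on rows. Each concerns at most four
    cells, hence survives unions of chains. The last clause uses signed column differences, which
    covers both orders of a pair. *)
Definition row_ok (p q r s : cell) := [/\ I p.1.1,
  p.1 = q.1 -> p.2 = q.2,
  p.1.1 = q.1.1 -> p.2 = q.2 -> p.1.2 = q.1.2 &
  p.1.1 = q.1.1 -> r.1.1 = s.1.1 -> p.2 = r.2 -> q.2 = s.2 ->
  q.1.2 - p.1.2 = s.1.2 - r.1.2 -> p.1.2 <> q.1.2 -> p.1 = r.1].

Definition cells_ok (p q r s : cell) := row_ok p q r s /\
  row_ok (transpose_cell p) (transpose_cell q)
         (transpose_cell r) (transpose_cell s).

Definition good_rows (P : set cell) :=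
  forall p q r s, P p -> P q -> P r -> P s -> row_ok p q r s.

Definition good (P : set cell) :=
  forall p q r s, P p -> P q -> P r -> P s -> cells_ok p q r s.

Lemma transpose_cellK : involutive transpose_cell.
Proof. by case=> [[]]. Qed.

Lemma transposeK : involutive transpose.
Proof.
by move=> P; apply/seteqP; split=> c; rewrite /transpose /= transpose_cellK.
Qed.

Lemma goodE P : good P <-> good_rows P /\ good_rows (transpose P).
Proof.
split=> [gP|[g1 g2] p q r s Pp Pq Pr Ps].
  split=> p q r s Pp Pq Pr Ps; first by have [] := gP _ _ _ _ Pp Pq Pr Ps.
  by have [_] := gP _ _ _ _ Pp Pq Pr Ps; rewrite !transpose_cellK.
by split; [exact: g1|apply: g2; rewrite /transpose /= transpose_cellK].
Qed.

Lemma good_transpose P : good P -> good (transpose P).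
Proof. by move=> /goodE[g1 g2]; apply/goodE; rewrite transposeK. Qed.

Lemma transposeU1 P c :
  transpose (P `|` [set c]) = transpose P `|` [set transpose_cell c].
Proof.
apply/seteqP; split=> d [Pd|e]; [by left|right|by left|right].
  by rewrite -[d]transpose_cellK e.
by rewrite e /= transpose_cellK.
Qed.

(** What a single new cell [c] must satisfy in the row direction. In the last clause [c] and [q]
    form the new pair, [r] and [s] an old one with the same symbols. *)
Definition addable (P : set cell) (c : cell) := [/\ I c.1.1,
  forall q, P q -> q.1 <> c.1,
  forall q, P q -> q.1.1 = c.1.1 -> q.2 <> c.2 &
  forall q r s, P q -> P r -> P s -> q.1.1 = c.1.1 -> r.1.1 = s.1.1 ->
    r.2 = c.2 -> s.2 = q.2 -> q.1.2 - c.1.2 <> s.1.2 - r.1.2].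

Lemma addable_new_row P c : I c.1.1 -> (forall q, P q -> q.1.1 <> c.1.1) ->
  addable P c.
Proof.
move=> Ic new; split=> // [q Pq e|q Pq e|q r s Pq _ _ e]; case: (new _ Pq) => //.
by rewrite e.
Qed.

(** Two equal pairs in one row coincide, since a symbol occurs there only once. In different rows,
    [c] lies in only one of the pairs and fills only one of its places; exchanging the pairs or
    reversing both reduces the four positions of [c] to the last clause of [addable]. *)
Lemma good_rowsU1 P c : good_rows P -> addable P c ->
  good_rows (P `|` [set c]).
Proof.
move=> gP [Ic cell0 sym0 pair0].
have symU p q : (P `|` [set c]) p -> (P `|` [set c]) q ->
    p.1.1 = q.1.1 -> p.2 = q.2 -> p = q.
  move=> [Pp|->] [Pq|->] e1 e2 //.
  - have [_ _ /(_ e1 e2) e3 _] := gP _ _ _ _ Pp Pq Pp Pp.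
    by move: p q e1 e2 e3 {Pp Pq} => [[? ?] ?] [[? ?] ?] /= -> -> ->.
  - by case: (sym0 _ Pp).
  - by case: (sym0 _ Pq).
move=> p q r s Hp Hq Hr Hs; split.
- by case: Hp => [Pp|->] //; have [] := gP _ _ _ _ Pp Pp Pp Pp.
- case: Hp => [Pp|->]; case: Hq => [Pq|->] //.
  + by have [_ + _ _] := gP _ _ _ _ Pp Pq Pp Pp.
  + by move=> /(cell0 _ Pp).
  + by move=> e; case: (cell0 _ Pq).
- by move=> e1 e2; rewrite (symU p q).
move=> pq rs pr qs e npq.
have [e1|e1] := pselect (p.1.1 = r.1.1); first by rewrite (symU p r).
have e2 : q.1.1 <> s.1.1 by rewrite -pq -rs.
have neg (a b u v : F) : a - b = u - v -> b - a = v - u.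
  by move=> ab; rewrite -opprB ab opprB.
case: Hp Hr => [Pp|pc] [Pr|rc]; last by case: e1; rewrite pc rc.
- case: Hq Hs => [Pq|qc] [Ps|sc]; last by case: e2; rewrite qc sc.
  + by have [_ _ _ ] := gP _ _ _ _ Pp Pq Pr Ps; apply.
  + rewrite sc in rs qs e.
    by case: (pair0 _ _ _ Pr Pq Pp rs (esym pq) qs pr); apply: neg.
  + rewrite qc in pq qs e.
    by case: (pair0 _ _ _ Pp Ps Pr pq (esym rs) (esym qs) (esym pr)); apply: neg.
- case: Hq => [Pq|qc]; last by case: e1; rewrite rc pq qc.
  case: Hs => [Ps|sc]; last first.
    by case: npq; apply/eqP; rewrite eq_sym -subr_eq0 e rc sc subrr.
  rewrite rc in rs pr e.
  by case: (pair0 _ _ _ Ps Pp Pq (esym rs) pq pr qs).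
- case: Hq => [Pq|qc]; last by case: npq; rewrite pc qc.
  case: Hs => [Ps|sc]; last by case: e1; rewrite pc rs sc.
  rewrite pc in pq pr e.
  by case: (pair0 _ _ _ Pq Pr Ps (esym pq) rs (esym pr) (esym qs)).
Qed.

Lemma goodU1 P c : good P -> addable P c ->
  addable (transpose P) (transpose_cell c) -> good (P `|` [set c]).
Proof.
move=> /goodE[g1 g2] a1 a2; apply/goodE; rewrite transposeU1.
by split; apply: good_rowsU1.
Qed.

Lemma good_set1 c : I c.1.1 -> I c.1.2 -> good [set c].
Proof.
move=> I1 I2; rewrite -[[set c]]set0U.
by apply: goodU1 => [p q r s []||]; apply: addable_new_row => // q [].
Qed.

Lemma good_symbol P i j x y : good P -> P (i, j, x) -> P (i, j, y) -> x = y.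
Proof.
move=> /goodE[g1 _] Px Py.
by have [_ /(_ erefl)] := g1 _ _ _ _ Px Py Px Px.
Qed.

Lemma good_col P i j j' x : good P -> P (i, j, x) -> P (i, j', x) -> j = j'.
Proof.
move=> /goodE[g1 _] Pj Pj'.
by have [_ _ /(_ erefl erefl)] := g1 _ _ _ _ Pj Pj' Pj Pj.
Qed.

Lemma good_pair P d i j i' j' x y : good P -> 0 < d ->
  P (i, j, x) -> P (i, j + d, y) -> P (i', j', x) -> P (i', j' + d, y) ->
  (i, j) = (i', j').
Proof.
move=> /goodE[g1 _] d0 P1 P2 P3 P4; have [_ _ _ ] := g1 _ _ _ _ P1 P2 P3 P4.
apply=> //=; first by rewrite [j + d]addrC [j' + d]addrC !addrK.
by move/eqP; rewrite -subr_eq0 opprD addNKr oppr_eq0 gt_eqF.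
Qed.

(** Rows, columns and symbols all lie in [F], so one small set collects everything a fresh choice
    has to avoid. *)
Definition entries (P : set cell) : set F :=
  [set c.1.1 | c in P] `|` [set c.1.2 | c in P] `|` [set c.2 | c in P].

(** These tasks are the existence halves of the conditions, complementing [row_ok]; the column
    versions are the same tasks for [transpose P]. *)
Definition symbol_task i x (P : set cell) := I i -> exists j, P (i, j, x).

Definition pair_task d x y (P : set cell) :=
  0 < d -> shift_dom I d !=set0 -> x <> y ->
  exists i j, P (i, j, x) /\ P (i, j + d, y).

Definition cell_task i j (P : set cell) := I i -> I j -> exists x, P (i, j, x).

(** * Meeting one task with at most two new cells *)

Hypothesis hI : index_set I.

Lemma infinite_realField : infinite_set [set: F].
Proof.
apply/infiniteP; apply: (card_le_fun (f := fun n => n%:R : F)) => //.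
by move=> m n _ _ /eqP; rewrite eqr_nat => /eqP.
Qed.
Local Notation Finf := infinite_realField.
Local Notation small := (small F).

Lemma small_entries P : small P -> small (entries P).
Proof.
by move=> sP; do 2?[apply: (small_setU Finf)]; apply: small_image.
Qed.

(** The scalars [a + b - c] form an image of the cube of [N], which is small and so cannot cover
    [J]. Taking [a = b = c] shows that [j] also avoids [N] itself. *)
Lemma exists_fresh (J N : set F) : [set: F] #<= J -> small N ->
  exists2 j, J j & forall a b c, N a -> N b -> N c -> j <> a + b - c.
Proof.
move=> FJ sN; apply: contrapT => H.
pose f (p : F * F * F) := p.1.1 + p.1.2 - p.2.
apply: (small_image (f := f) (small_setX Finf (small_setX Finf sN sN) sN)).
apply: card_le_trans FJ _; apply: subset_card_le => j Jj.
apply: contrapT => Nj; apply: H; exists j => // a b c Na Nb Nc e.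
by apply: Nj; exists (a, b, c).
Qed.

(** A fresh symbol [x] can repeat neither a symbol nor a pair. *)
Lemma cell_extension i j P : small P -> good P -> ~ cell_task i j P ->
  exists c1 c2, good (P `|` [set c1; c2]) /\ cell_task i j (P `|` [set c1; c2]).
Proof.
move=> sP gP /not_implyP[Ii /not_implyP[Ij NP]].
have [x _ xN] := exists_fresh (card_lexx _) (small_entries sP).
have {}xN a : entries P a -> a <> x by move=> Na e; apply: (xN a a a); rewrite ?addrK.
exists (i, j, x), (i, j, x); rewrite setUid; split; last by exists x; right.
have ent q : P q -> q.2 <> x by move=> Pq; apply: xN; right; exists q.
have empty q : P q -> q.1 <> (i, j).
  by move=> Pq e; apply: NP; exists q.2; rewrite -e -surjective_pairing.
apply: goodU1 => //; split=> //=.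
- by move=> q /ent nx _.
- by move=> q r s _ /ent nx _ _ _ /nx.
- by move=> q /empty /= + e; apply; rewrite e.
- by move=> q /ent nx _.
- by move=> q r s _ /ent nx _ _ _ /nx.
Qed.

Lemma symbol_extension i x P : small P -> good P -> ~ symbol_task i x P ->
  exists c1 c2, good (P `|` [set c1; c2]) /\ symbol_task i x (P `|` [set c1; c2]).
Proof.
move=> sP gP /not_implyP[Ii NP].
have FI : [set: F] #<= I by case: hI => /card_eqPle[].
have [j Ij jN] := exists_fresh FI (small_entries sP).
have ent q : P q -> entries P q.1.2 by move=> Pq; left; right; exists q.
have {}ent' q : P q -> q.1.2 <> j.
  by move=> /ent Nq e; apply: (jN _ _ _ Nq Nq Nq); rewrite addrK.
exists (i, j, x), (i, j, x); rewrite setUid; split; last by exists j; right.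
apply: goodU1 => //; last by apply: addable_new_row => // q /ent'.
split=> //= [q Pq e|q Pq e1 e2|q r s Pq Pr Ps _ _ _ _ e].
- by apply: (ent' _ Pq); rewrite e.
- by apply: NP; exists q.1.2; rewrite -e1 -e2 -!surjective_pairing.
(* A repeated pair would force the fresh column [j] to be [q.1.2 + r.1.2 - s.1.2]. *)
- apply: (jN _ _ _ (ent _ Pq) (ent _ Pr) (ent _ Ps)).
  by rewrite -addrA -opprB -e opprB addrC subrK.
Qed.

(** Both cells go into a new row [i] and into new columns [j] and [j + d]. The only pair they create
    is [(x, y)] at distance [d], absent from [P] because the task is unmet. *)
Lemma pair_extension d x y P : small P -> good P -> ~ pair_task d x y P ->
  exists c1 c2, good (P `|` [set c1; c2]) /\ pair_task d x y (P `|` [set c1; c2]).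
Proof.
move=> sP gP /not_implyP[d0 /not_implyP[Id /not_implyP[xy NP]]].
have FI : [set: F] #<= I by case: hI => /card_eqPle[].
have FId : [set: F] #<= shift_dom I d.
  have [_ /(_ _ d0)[/card_eqPle[]//|e]] := hI.
  by case: Id => z; rewrite e.
(* With [0] and [d] in [N], freshness of [j] also excludes [j = a + 0 - d], so that column [j + d]
   is new as well. *)
pose N := entries P `|` [set 0; d].
have sN : small N.
  apply: (small_setU Finf); first exact: small_entries.
  by apply: (finite_small Finf); apply: finite_set2.
have [i Ii iN] := exists_fresh FI sN.
have [j [Ij Ijd] jN] := exists_fresh FId sN.
have row q : P q -> q.1.1 <> i.
  move=> Pq e; have Nq : N q.1.1 by left; left; left; exists q.
  by apply: (iN _ _ _ Nq Nq Nq); rewrite addrK.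
have col q : P q -> q.1.2 <> j.
  move=> Pq e; have Nq : N q.1.2 by left; left; right; exists q.
  by apply: (jN _ _ _ Nq Nq Nq); rewrite addrK.
have cold q : P q -> q.1.2 <> j + d.
  move=> Pq e; have Nq : N q.1.2 by left; left; right; exists q.
  apply: (jN _ _ _ Nq (_ : N 0) (_ : N d)); [by right; left|by right; right|].
  by rewrite addr0 e addrK.
have jd : j <> j + d.
  by move/eqP; rewrite -subr_eq0 opprD addNKr oppr_eq0 gt_eqF.
exists (i, j, x), (i, j + d, y); rewrite setUA; split; last first.
  by exists i, j; split; [left; right|right].
apply: goodU1.
- by apply: goodU1 => //; apply: addable_new_row => //= q /col.
- split=> //= [q [Pq|->]|q [Pq|->]|].
  + by move=> e; apply: (row _ Pq); rewrite e.
  + by case.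
  + by move=> /(row _ Pq).
  + by move=> _.
  + move=> q r s [Pq|->] /= Hr Hs; first by move/(row _ Pq).
    move=> _ rs ry sx; case: Hr ry rs => [Pr|-> //] ry rs.
    case: Hs sx rs => [Ps|->] /= sx rs e; last by apply: (row _ Pr).
    apply: NP; exists s.1.1, s.1.2; rewrite -{1}sx -!surjective_pairing; split=> //.
    have -> : s.1.2 + d = r.1.2 by move: e; rewrite opprD addNKr; lra.
    by rewrite -rs -ry -!surjective_pairing.
- rewrite transposeU1; apply: addable_new_row => //= q [/cold//|->] /=.
  exact: jd.
Qed.

Lemma transpose_extension (Q : set cell -> Prop) P :
  (forall P, small P -> good P -> ~ Q P ->
    exists c1 c2, good (P `|` [set c1; c2]) /\ Q (P `|` [set c1; c2])) ->
  small P -> good P -> ~ Q (transpose P) ->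
  exists c1 c2, good (P `|` [set c1; c2]) /\ Q (transpose (P `|` [set c1; c2])).
Proof.
move=> extQ sP gP NQ; have [||c1 [c2 [g Qc]]] := extQ (transpose P) _ _ NQ.
- apply: small_le sP; apply: (card_le_fun (f := transpose_cell)) => // c d _ _.
  exact: (can_inj transpose_cellK).
- exact: good_transpose.
exists (transpose_cell c1), (transpose_cell c2).
have <- : transpose (transpose P `|` [set c1; c2]) =
    P `|` [set transpose_cell c1; transpose_cell c2].
  by rewrite setUA !transposeU1 transposeK setUA.
by rewrite transposeK; split=> //; apply: good_transpose.
Qed.

(* Tasks are coded in [F ^ 4], so that [card_le_square] enumerates them by [F]. *)
Definition task (t : (F * F) * (F * F)) (P : set cell) : Prop :=
  let: ((e, a), (b, c)) := t in
  if e == 0 then cell_task a b P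
  else if e == 1 then symbol_task a b P
  else if e == 2 then symbol_task a b (transpose P)
  else if e == 3 then pair_task a b c P
  else pair_task a b c (transpose P).

Lemma task_extension t P : small P -> good P -> ~ task t P ->
  exists c1 c2, good (P `|` [set c1; c2]) /\ task t (P `|` [set c1; c2]).
Proof.
case: t => [[e a] [b c]]; rewrite /task; do 4?case: ifP => _.
- exact: cell_extension.
- exact: symbol_extension.
- apply: (transpose_extension (Q := symbol_task a b) (@symbol_extension a b)).
- exact: pair_extension.
- apply: (transpose_extension (Q := pair_task a b c) (@pair_extension a b c)).
Qed.

Lemma task_mono t P Q : P `<=` Q -> task t P -> task t Q.
Proof.
move=> PQ; have tPQ c : transpose P c -> transpose Q c by apply: PQ.
case: t => [[e a] [b c]]; rewrite /task; do 4?case: ifP => _.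
- by move=> + Ia Ib => /(_ Ia Ib)[x Px]; exists x; apply: PQ.
- by move=> + Ia => /(_ Ia)[x Px]; exists x; apply: PQ.
- by move=> + Ia => /(_ Ia)[x Px]; exists x; apply: tPQ.
- move=> + d0 Id xy => /(_ d0 Id xy)[i [j [P1 P2]]].
  by exists i, j; split; apply: PQ.
- move=> + d0 Id xy => /(_ d0 Id xy)[i [j [P1 P2]]].
  by exists i, j; split; apply: tPQ.
Qed.

(** A left inverse [u] of an injection of pairs into [F] is onto; applying it twice decodes four
    scalars from one. *)
Lemma task_enumeration : exists u : F -> (F * F) * (F * F),
  forall t, exists k, u k = t.
Proof.
have := card_le_square Finf; rewrite setXTT.
move=> /(card_le_ex 0) [g _ gI].
have {}gI p q : g p = g q -> p = q by move=> e; apply: gI; rewrite ?inE.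
have /choice[u uP] : forall k, exists p, forall q, g q = k -> p = q.
  move=> k; have [[p <-]|N] := pselect (exists p, g p = k).
    by exists p => q /gI.
  by exists (0, 0) => q e; case: N; exists q.
have gK p : u (g p) = p by apply: uP.
exists (fun k => (u (u k).1, u (u k).2)) => -[p q].
by exists (g (g p, g q)); rewrite !gK.
Qed.

Lemma exists_complete_square (i0 i1 : F) : I i0 -> I i1 -> i0 <> i1 ->
  exists P, [/\ good P, P (i0, i0, 0), P (i1, i1, 1) & forall t, task t P].
Proof.
move=> I0 I1 i01; have [u uP] := task_enumeration.
pose P0 : set cell := [set (i0, i0, 0)] `|` [set (i1, i1, 1)].
have gP0 : good P0.
  apply: goodU1; first exact: good_set1.
    by apply: addable_new_row => // q ->.
  by apply: addable_new_row => // -[[a b] c] [_ ->].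
have [|||||P [P0P gP satP]] := @transfinite_construction F cell cells_ok
    (fun k => task (u k)) P0 (i0, i0, 0) Finf.
- by move=> k P Q; exact: task_mono.
- by left.
- by apply: (finite_small Finf); apply: finite_set2.
- exact: gP0.
- by move=> k P _ sP gP; apply: task_extension.
exists P; split=> //; [by apply: P0P; left|by apply: P0P; right|].
by move=> t; have [k <-] := uP t; exact: satP.
Qed.

End PartialSquares.

(** * From the completed set of cells to the square *)

Lemma based_on_diagonal (F : realFieldType) (I : set F) X (L : F -> F -> X)
    (G : groupType) i j : based_on I L G -> I i -> I j -> L i i = L j j.
Proof. by move=> [a [sigma [_ _ LE]]] Ii Ij; rewrite !LE // !mulVg. Qed.

Lemma index_set_two (F : realFieldType) (I : set F) : index_set I ->
  exists i j, [/\ I i, I j & i <> j].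
Proof.
move=> [/card_eqPle[_ FI] _]; have [f fI fi] := card_le_ex 0 FI.
exists (f 0), (f 1); split; try exact: fI.
by move=> /fi; rewrite !inE => /(_ Logic.I Logic.I)/eqP; rewrite eq_sym oner_eq0.
Qed.

Theorem theorem3p2 (F : realFieldType) (I : set F) (hI : index_set I) :
  exists (X : Type) (L : F -> F -> X),
    vatican_square I L /\ ~ (exists G : groupType, based_on I L G).
Proof.
have [i0 [i1 [I0 I1 i01]]] := index_set_two hI.
have [P [gP P00 P11 taskP]] := exists_complete_square hI I0 I1 i01.
(* The task codes 0 to 4 are distinct because an ordered field has characteristic zero. *)
have n10 : (1 == 0 :> F) = false by rewrite oner_eq0.
have n20 : (2 == 0 :> F) = false by rewrite pnatr_eq0.
have n30 : (3 == 0 :> F) = false by rewrite pnatr_eq0.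
have n40 : (4 == 0 :> F) = false by rewrite pnatr_eq0.
have n21 : (2 == 1 :> F) = false by rewrite (eqr_nat F 2 1).
have n31 : (3 == 1 :> F) = false by rewrite (eqr_nat F 3 1).
have n41 : (4 == 1 :> F) = false by rewrite (eqr_nat F 4 1).
have n32 : (3 == 2 :> F) = false by rewrite (eqr_nat F 3 2).
have n42 : (4 == 2 :> F) = false by rewrite (eqr_nat F 4 2).
have n43 : (4 == 3 :> F) = false by rewrite (eqr_nat F 4 3).
have cellP i j : I i -> I j -> exists x, P (i, j, x).
  by have := taskP ((0, i), (j, 0)); rewrite /task eqxx.
have rowP i x : I i -> exists j, P (i, j, x).
  by have := taskP ((1, i), (x, 0)); rewrite /task n10 eqxx.
have colP j x : I j -> exists i, P (i, j, x).
  by have := taskP ((2, j), (x, 0)); rewrite /task n20 n21 eqxx.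
have rpairP d x y : 0 < d -> shift_dom I d !=set0 -> x <> y ->
    exists i j, P (i, j, x) /\ P (i, j + d, y).
  by have := taskP ((3, d), (x, y)); rewrite /task n30 n31 n32 eqxx.
have cpairP d x y : 0 < d -> shift_dom I d !=set0 -> x <> y ->
    exists j i, P (i, j, x) /\ P (i + d, j, y).
  have := taskP ((4, d), (x, y)); rewrite /task n40 n41 n42 n43.
  move=> + d0 Id xy => /(_ d0 Id xy)[j [i H]].
  by exists j, i.
have gPT := good_transpose gP.
have PI i j x : P (i, j, x) -> I i /\ I j.
  by move=> H; have [[? _ _ _] [? _ _ _]] := gP _ _ _ _ H H H H.
(* The default [0] is taken only where [P] has no cell, hence never on [I]. *)
pose L i j := xget 0 [set x | P (i, j, x)].
have PL i j : I i -> I j -> P (i, j, L i j).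
  by move=> Ii Ij; apply: (@xgetPex _ 0 [set x | P (i, j, x)]); exact: cellP.
have LP i j x : P (i, j, x) -> L i j = x.
  by move=> H; have [Ii Ij] := PI _ _ _ H; apply: (good_symbol gP (PL _ _ Ii Ij) H).
exists F, L; split; last first.
  move=> [G /based_on_diagonal/(_ I0 I1)].
  by rewrite (LP _ _ _ P00) (LP _ _ _ P11) => /esym/eqP; rewrite oner_eq0.
split.
  move=> i Ii; split; split.
  - by [].
  - move=> j k /set_mem Ij /set_mem Ik e; apply: (good_col gP (PL _ _ Ii Ij)).
    by rewrite e; exact: PL.
  - move=> x _; have [j Pj] := rowP i x Ii; exists j; last exact: LP.
    by have [] := PI _ _ _ Pj.
  - by [].
  - move=> j k /set_mem Ij /set_mem Ik e.
    apply: (@good_col _ _ _ i j k (L j i) gPT); first exact: PL.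
    by rewrite e; exact: PL.
  - move=> x _; have [j Pj] := colP i x Ii; exists j; last exact: LP.
    by have [] := PI _ _ _ Pj.
move=> d d0 Id x y xy; split.
  have [i [j [Px Py]]] := rpairP d x y d0 Id xy; exists (i, j); split=> /=.
    by have [Ii Ij] := PI _ _ _ Px; have [_ Ijd] := PI _ _ _ Py; split=> //; exact: LP.
  move=> [i' j'] [/= Ii' [Ij' Ijd'] Lx Ly].
  by apply: (good_pair gP d0 Px Py); [rewrite -Lx|rewrite -Ly]; exact: PL.
have [j [i [Px Py]]] := cpairP d x y d0 Id xy; exists (i, j); split=> /=.
  by have [Ii Ij] := PI _ _ _ Px; have [Iid _] := PI _ _ _ Py; split=> //; exact: LP.
move=> [i' j'] [/= [Ii' Iid'] Ij' Lx Ly].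
(* Columns of [P] are rows of its transpose, so the row statement applies with the coordinates
   exchanged. *)
suff [-> ->] : (j, i) = (j', i') by [].
apply: (@good_pair _ _ _ d j i j' i' x y gPT d0) => //.
  by rewrite -Lx; exact: (PL i' j').
by rewrite -Ly; exact: (PL (i' + d) j').
Qed.
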